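(* Let $G$ be the group of Listing's knot, given by generators $a_1,a_2,a_3,a_4,a_5$ and the defining relations $$a_3a_4^{-1}a_1=a_1a_2^{-1}a_3=a_1a_4^{-1}a_5a_2^{-1}=a_3a_2^{-1}a_5a_4^{-1}=1.$$ Let $\overline{j}_0$ be the automorphism of $G$ given by $$a_1\mapsto a_3^{-1},\quad a_2\mapsto a_2^{-1},\quad a_3\mapsto a_1^{-1},\quad a_4\mapsto a_4^{-1},\quad a_5\mapsto a_5^{-1},$$ and let $\overline{j}_1$ be the automorphism of $G$ given by $$a_1\mapsto a_2a_5^{-1},\quad a_2\mapsto a_3a_5^{-1},\quad a_3\mapsto a_4a_5^{-1},\quad a_4\mapsto a_1a_5^{-1},\quad a_5\mapsto a_5^{-1}.$$ Then the automorphism group of $G$ is generated by $\overline{j}_0$, $\overline{j}_1$ and the inner automorphisms of $G$.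
   Context: Listing's knot is the figure-eight knot. The displayed assignments do define automorphisms of $G$. *)

(* Defs.v *)
From HB Require Import structures.
From mathcomp Require Import all_boot.
From mathcomp Require Import boolp classical_sets.

Set Implicit Arguments.
Unset Strict Implicit.
Unset Printing Implicit Defensive.

Local Open Scope classical_set_scope.
Local Open Scope group_scope.
Local Open Scope quotient_scope.

(* A letter (x, false) stands for the generator x, and (x, true) for x^-1. *)
Definition word (X : choiceType) := seq (X * bool).

Definition pos {X : choiceType} (x : X) : X * bool := (x, false).
Definition neg {X : choiceType} (x : X) : X * bool := (x, true).

Definition wordV {X : choiceType} (u : word X) : word X :=
  rev [seq (l.1, ~~ l.2) | l <- u].

(* The congruence on words generated by free cancellation and r ~ 1, r \in R;
   its quotient is the free group on X modulo the normal closure of R. *)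
Inductive weq {X : choiceType} (R : seq (word X)) : word X -> word X -> Prop :=
| weq_refl u : weq R u u
| weq_sym u v : weq R u v -> weq R v u
| weq_trans v u w : weq R u v -> weq R v w -> weq R u w
| weq_cat u u' v v' : weq R u u' -> weq R v v' -> weq R (u ++ v) (u' ++ v')
| weq_cancel x b : weq R [:: (x, b); (x, ~~ b)] [::]
| weq_relator r : r \in R -> weq R r [::].

Section Presentation.
Variables (X : choiceType) (R : seq (word X)).
Implicit Types u v : word X.

Definition weqb u v : bool := `[< weq R u v >].

Lemma weqb_refl : reflexive weqb.
Proof. by move=> u; apply/asboolP/weq_refl. Qed.

Lemma weqb_sym : symmetric weqb.
Proof. by move=> u v; apply/asboolP/asboolP; apply: weq_sym. Qed.

Lemma weqb_trans : transitive weqb.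
Proof.
by move=> v u w /asboolP uv /asboolP vw; apply/asboolP/(weq_trans uv vw).
Qed.

Definition weq_equiv := EquivRel weqb weqb_refl weqb_sym weqb_trans.

Definition presented := {eq_quot weq_equiv}.
HB.instance Definition _ := Choice.on presented.

Definition pclass (u : word X) : presented := \pi_({eq_quot weq_equiv}) u.
Definition prepr (g : presented) : word X := repr (g : {eq_quot weq_equiv}).

Lemma preprK g : pclass (prepr g) = g.
Proof. exact: reprK. Qed.

Lemma pclassP u v : pclass u = pclass v <-> weq R u v.
Proof.
split=> [/eqP|uv]; first by rewrite /pclass piE => /asboolP.
by apply/eqP; rewrite /pclass piE; apply/asboolP.
Qed.

Lemma wordV_cat u v : wordV (u ++ v) = wordV v ++ wordV u.
Proof. by rewrite /wordV map_cat rev_cat. Qed.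

Lemma wordVK : involutive (@wordV X).
Proof.
move=> u; rewrite /wordV map_rev revK -map_comp -[RHS]map_id.
by apply: eq_map => -[x b] /=; rewrite negbK.
Qed.

Lemma weq_catV u : weq R (u ++ wordV u) [::].
Proof.
elim: u => [|[x b] u IHu]; first exact: weq_refl.
rewrite -cat1s wordV_cat -catA (catA u).
apply: weq_trans (weq_cancel R x b).
apply: (weq_cat (u := [:: (x, b)]) (u' := [:: (x, b)])); first exact: weq_refl.
apply: (weq_cat (u' := [::]) IHu); exact: weq_refl.
Qed.

Lemma weq_Vcat u : weq R (wordV u ++ u) [::].
Proof. by rewrite -{2}(wordVK u); apply: weq_catV. Qed.

Lemma weq_wordV u v : weq R u v -> weq R (wordV u) (wordV v).
Proof.
move=> uv; rewrite -[wordV u]cats0.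
apply: (weq_trans (weq_cat (weq_refl R _) (weq_sym (weq_catV v)))).
rewrite catA -[X in weq _ _ X]cat0s; apply: weq_cat; last exact: weq_refl.
apply: weq_trans (weq_Vcat u).
by apply: weq_cat; [exact: weq_refl | exact: weq_sym].
Qed.

Definition pmul (g h : presented) : presented := pclass (prepr g ++ prepr h).
Definition pone : presented := pclass [::].
Definition pinv (g : presented) : presented := pclass (wordV (prepr g)).

Lemma pclass_cat u v : pclass (u ++ v) = pmul (pclass u) (pclass v).
Proof. by apply/pclassP/weq_cat; apply/pclassP; rewrite preprK. Qed.

Lemma pclassV u : pclass (wordV u) = pinv (pclass u).
Proof. by apply/pclassP/weq_wordV/pclassP; rewrite preprK. Qed.

Lemma pmulA : associative pmul.
Proof.
move=> g h k; rewrite -(preprK g) -(preprK h) -(preprK k).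
by rewrite -!pclass_cat catA.
Qed.

Lemma pmul1g : left_id pone pmul.
Proof. by move=> g; rewrite -{1}(preprK g) -pclass_cat preprK. Qed.

Lemma pmulg1 : right_id pone pmul.
Proof. by move=> g; rewrite -{1}(preprK g) -pclass_cat cats0 preprK. Qed.

Lemma pmulVg : left_inverse pone pinv pmul.
Proof.
by move=> g; rewrite -(preprK g) -pclassV -pclass_cat; apply/pclassP/weq_Vcat.
Qed.

Lemma pmulgV : right_inverse pone pinv pmul.
Proof.
by move=> g; rewrite -(preprK g) -pclassV -pclass_cat; apply/pclassP/weq_catV.
Qed.

HB.instance Definition _ :=
  isGroup.Build presented pmulA pmul1g pmulg1 pmulVg pmulgV.

Definition pgen (x : X) : presented := pclass [:: pos x].

Lemma pclassM u v : pclass (u ++ v) = pclass u * pclass v.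
Proof. exact: pclass_cat. Qed.

Lemma pclass_wordV u : pclass (wordV u) = (pclass u)^-1.
Proof. exact: pclassV. Qed.

End Presentation.

Definition eval_letter {X : choiceType} {H : groupType} (f : X -> H)
    (l : X * bool) : H := if l.2 then (f l.1)^-1 else f l.1.

Definition eval_word {X : choiceType} {H : groupType} (f : X -> H)
    (u : word X) : H := \prod_(l <- u) eval_letter f l.

(* The map sending each generator x to f x; it is a homomorphism when f
   satisfies the relators, see pliftM and plift_gen. *)
Definition plift {X : choiceType} {R : seq (word X)} {H : groupType}
    (f : X -> H) (g : presented R) : H := eval_word f (prepr g).

Lemma eval_cat (X : choiceType) (H : groupType) (f : X -> H) (u v : word X) :
  eval_word f (u ++ v) = eval_word f u * eval_word f v.
Proof. exact: big_cat. Qed.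

Section UniversalProperty.
Variables (X : choiceType) (R : seq (word X)) (H : groupType).

Lemma eval_pgen (u : word X) : eval_word (pgen R) u = pclass R u.
Proof.
elim: u => [|l u IHu]; first by rewrite /eval_word big_nil.
rewrite -cat1s eval_cat pclassM IHu; congr (_ * _).
rewrite /eval_word big_seq1; case: l => x [] //.
by rewrite /eval_letter /= /pgen -pclass_wordV.
Qed.

Lemma pgen_relator r : r \in R -> eval_word (pgen R) r = 1.
Proof. by move=> Rr; rewrite eval_pgen; apply/pclassP/weq_relator. Qed.

Section Lift.
Variable f : X -> H.
Hypothesis fR : forall r, r \in R -> eval_word f r = 1.

Lemma eval_weq u v : weq R u v -> eval_word f u = eval_word f v.
Proof.
elim=> {u v} // [v u w _ -> _ -> //|u u' v v' _ IHu _ IHv|x b|r /fR->].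
- by rewrite !eval_cat IHu IHv.
- rewrite /eval_word !big_cons !big_nil mulg1 /eval_letter /=.
  by case: b; rewrite /= (mulVg, mulgV).
- by rewrite /eval_word big_nil.
Qed.

Lemma plift_class u : plift f (pclass R u) = eval_word f u.
Proof. by apply/eval_weq/pclassP; rewrite preprK. Qed.

Lemma pliftM : {morph (plift f : presented R -> H) : x y / x * y}.
Proof.
move=> x y; rewrite -(preprK x) -(preprK y) -pclassM.
by rewrite !plift_class eval_cat.
Qed.

Lemma plift_gen x : plift f (pgen R x) = f x.
Proof. by rewrite plift_class /eval_word big_seq1. Qed.

End Lift.

Lemma presented_eq (p q : presented R -> H) :
  {morph p : x y / x * y} -> {morph q : x y / x * y} ->
  (forall x, p (pgen R x) = q (pgen R x)) -> p =1 q.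
Proof.
have ev (k : presented R -> H) : {morph k : x y / x * y} ->
    forall u, k (pclass R u) = eval_word (k \o pgen R) u.
  move=> kM; have k1 : k 1 = 1 by apply: (mulgI (k 1)); rewrite -kM !mulg1.
  have kV x : k x^-1 = (k x)^-1.
    by apply: (mulgI (k x)); rewrite -kM !mulgV k1.
  elim=> [|l u IHu]; first by rewrite /eval_word big_nil.
  rewrite -cat1s pclassM kM IHu eval_cat; congr (_ * _).
  rewrite /eval_word big_seq1; case: l => x [] //.
  by rewrite /eval_letter /= -kV /pgen -pclass_wordV.
move=> pM qM pq g; rewrite -(preprK g) !ev //.
by apply: eq_bigr => -[x b] _; rewrite /eval_letter /= pq.
Qed.

End UniversalProperty.

Definition is_aut (G : groupType) (f : G -> G) : Prop :=
  {morph f : x y / x * y} /\ bijective f.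

Record autom (G : groupType) :=
  Autom { aut_fun :> G -> G; autP_subproof : `[< is_aut aut_fun >] }.

HB.instance Definition _ (G : groupType) := [isSub for @aut_fun G].
HB.instance Definition _ (G : groupType) := [Choice of autom G by <:].

Section AutomorphismGroup.
Variable G : groupType.
Implicit Types f g h : autom G.

Lemma autP f : is_aut f.
Proof. by case: f => f /= /asboolP. Qed.

Definition mk_aut (f : G -> G) (fP : is_aut f) : autom G := Autom (asboolT fP).

Lemma autom_eq f g : f =1 g -> f = g.
Proof. by move=> fg; apply/val_inj/funext. Qed.

Lemma aut_one_subproof : is_aut (@id G).
Proof. by split=> //; exists id. Qed.

Lemma aut_mul_subproof f g : is_aut (f \o g).
Proof.
have [[fM fB] [gM gB]] := (autP f, autP g).
by split; [move=> x y /=; rewrite gM fM | exact: bij_comp].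
Qed.

Lemma aut_inv_exists f : exists f' : G -> G, cancel f f' /\ cancel f' f.
Proof. by have [_ [f' fK f'K]] := autP f; exists f'. Qed.

Definition aut_inv_fun f : G -> G := projT1 (cid (aut_inv_exists f)).

Lemma aut_inv_funK f : cancel f (aut_inv_fun f).
Proof. by rewrite /aut_inv_fun; case: cid => ? []. Qed.

Lemma aut_inv_funVK f : cancel (aut_inv_fun f) f.
Proof. by rewrite /aut_inv_fun; case: cid => ? []. Qed.

Lemma aut_inv_subproof f : is_aut (aut_inv_fun f).
Proof.
have [fM _] := autP f; have fK := @aut_inv_funK f; have fVK := @aut_inv_funVK f.
by split; [move=> x y; rewrite -{1}(fVK x) -{1}(fVK y) -fM fK | exists f].
Qed.

Definition aut_one : autom G := mk_aut aut_one_subproof.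
Definition aut_mul f g : autom G := mk_aut (aut_mul_subproof f g).
Definition aut_inv f : autom G := mk_aut (aut_inv_subproof f).

Lemma aut_mulA : associative aut_mul.
Proof. by move=> f g h; apply: autom_eq. Qed.
Lemma aut_mul1g : left_id aut_one aut_mul.
Proof. by move=> f; apply: autom_eq. Qed.
Lemma aut_mulg1 : right_id aut_one aut_mul.
Proof. by move=> f; apply: autom_eq. Qed.
Lemma aut_mulVg : left_inverse aut_one aut_inv aut_mul.
Proof. by move=> f; apply/autom_eq/aut_inv_funK. Qed.
Lemma aut_mulgV : right_inverse aut_one aut_inv aut_mul.
Proof. by move=> f; apply/autom_eq/aut_inv_funVK. Qed.

HB.instance Definition _ := isGroup.Build (autom G)
  aut_mulA aut_mul1g aut_mulg1 aut_mulVg aut_mulgV.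

Lemma inner_subproof (g : G) : is_aut (fun x => g * x * g^-1).
Proof.
split=> [x y|]; first by rewrite -!mulgA mulKg.
exists (fun x => g^-1 * x * g) => x; rewrite !mulgA.
  by rewrite mulVg mul1g mulgVK.
by rewrite mulgV mul1g mulgK.
Qed.

Definition inner (g : G) : autom G := mk_aut (inner_subproof g).

Definition Inn : set (autom G) := range inner.

End AutomorphismGroup.

Arguments Inn : clear implicits.

Definition subgroup (G : groupType) : set (set G) :=
  [set S : set G | group_closed [in S]].

Lemma subgroupP (G : groupType) (S : set G) :
  subgroup S <->
  [/\ S 1, forall x y, S x -> S y -> S (x * y) & forall x, S x -> S x^-1].
Proof.
rewrite /subgroup /=; split=> [Sg|[S1 SM SV]].
- have [S1 _] := Sg; have SV := group_closedV Sg; have SM := group_closedM Sg.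
  split=> [|x y Sx Sy|x Sx]; first exact/set_mem.
  + by apply/set_mem/SM; exact/mem_set.
  + by apply/set_mem/SV; exact/mem_set.
- split; first exact/mem_set.
  move=> x y xS yS; apply/mem_set; apply: SM; first exact: set_mem.
  by apply: SV; exact: set_mem.
Qed.

Definition generated (G : groupType) (A : set G) : set G :=
  smallest (@subgroup G) A.

Inductive listing_gen := A1 | A2 | A3 | A4 | A5.
HB.instance Definition _ := gen_eqMixin listing_gen.
HB.instance Definition _ := gen_choiceMixin listing_gen.

Definition listing_relators : seq (word listing_gen) :=
  [:: [:: pos A3; neg A4; pos A1];
      [:: pos A1; neg A2; pos A3];
      [:: pos A1; neg A4; pos A5; neg A2];
      [:: pos A3; neg A2; pos A5; neg A4]].

Definition listing_group : groupType := presented listing_relators.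

Definition a1 : listing_group := pgen listing_relators A1.
Definition a2 : listing_group := pgen listing_relators A2.
Definition a3 : listing_group := pgen listing_relators A3.
Definition a4 : listing_group := pgen listing_relators A4.
Definition a5 : listing_group := pgen listing_relators A5.

Definition j0_gen (x : listing_gen) : listing_group :=
  match x with
  | A1 => a3^-1
  | A2 => a2^-1
  | A3 => a1^-1
  | A4 => a4^-1
  | A5 => a5^-1
  end.

Definition j1_gen (x : listing_gen) : listing_group :=
  match x with
  | A1 => a2 * a5^-1
  | A2 => a3 * a5^-1
  | A3 => a4 * a5^-1
  | A4 => a1 * a5^-1
  | A5 => a5^-1
  end.

Lemma listing_relations :
  [/\ a3 * a4^-1 * a1 = 1, a1 * a2^-1 * a3 = 1,
      a1 * a4^-1 * a5 * a2^-1 = 1 & a3 * a2^-1 * a5 * a4^-1 = 1].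
Proof.
have E r : r \in listing_relators -> eval_word (pgen listing_relators) r = 1.
  exact: pgen_relator.
split; [have := E [:: pos A3; neg A4; pos A1]
       |have := E [:: pos A1; neg A2; pos A3]
       |have := E [:: pos A1; neg A4; pos A5; neg A2]
       |have := E [:: pos A3; neg A2; pos A5; neg A4]];
  by rewrite /eval_word !big_cons big_nil mulg1 !mulgA => ->;
     rewrite // !inE eqxx ?orbT.
Qed.

Section ListingRelations.
Variables (H : groupType) (f : listing_gen -> H).

Lemma listing_evalP :
  f A3 * (f A4)^-1 * f A1 = 1 -> f A1 * (f A2)^-1 * f A3 = 1 ->
  f A1 * (f A4)^-1 * f A5 * (f A2)^-1 = 1 ->
  f A3 * (f A2)^-1 * f A5 * (f A4)^-1 = 1 ->
  forall r, r \in listing_relators -> eval_word f r = 1.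
Proof.
move=> r1 r2 r3 r4 r; rewrite !inE.
by case/or4P => /eqP ->; rewrite /eval_word !big_cons big_nil mulg1 !mulgA.
Qed.

End ListingRelations.

Lemma listing_solved :
  [/\ a4 = a1 * a3, a2 = a3 * a1, a5 = a4 * a1^-1 * a2 & a5 = a2 * a3^-1 * a4].
Proof.
have [r1 r2 r3 r4] := listing_relations; split.
- have := mulg1_eq r1; rewrite invgM invgK => e.
  by rewrite -e mulgVK.
- have := mulg1_eq r2; rewrite invgM invgK => e.
  by rewrite -e mulgVK.
- by rewrite -(divg1_eq r3) !mulgA mulgVK mulgV mul1g.
- by rewrite -(divg1_eq r4) !mulgA mulgVK mulgV mul1g.
Qed.

Lemma j0_relators r :
  r \in listing_relators -> eval_word j0_gen r = 1.
Proof.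
have [e4 e2 e5 e5'] := listing_solved.
apply: listing_evalP => /=; rewrite ?invgK.
- by rewrite e4 mulgA mulVg mul1g mulgV.
- by rewrite e2 mulgA mulVg mul1g mulgV.
- by rewrite e5' !invgM invgK !mulgA mulgK mulVg mul1g mulVg.
- by rewrite e5 !invgM invgK !mulgA mulgK mulVg mul1g mulVg.
Qed.

Lemma j1_relators r :
  r \in listing_relators -> eval_word j1_gen r = 1.
Proof.
have [e4 e2 e5 e5'] := listing_solved.
apply: listing_evalP => /=; rewrite ?invgM ?invgK !mulgA ?mulgVK.
- by rewrite -e5 mulgV.
- by rewrite -e5' mulgV.
- by rewrite ?mulgVK e2 ?invgM ?mulgA ?mulgK ?mulgV.
- by rewrite ?mulgVK e4 ?invgM ?mulgA ?mulgK ?mulgV.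
Qed.

Definition j0_fun : listing_group -> listing_group := plift j0_gen.
Definition j1_fun : listing_group -> listing_group := plift j1_gen.

Lemma listing_morphV (f : listing_group -> listing_group) :
  {morph f : x y / x * y} -> {morph f : x / x^-1}.
Proof.
move=> fM x; have f1 : f 1 = 1 by apply: (mulgI (f 1)); rewrite -fM !mulg1.
by apply: (mulgI (f x)); rewrite -fM !mulgV.
Qed.

Lemma j0_funM : {morph j0_fun : x y / x * y}.
Proof. exact: pliftM j0_relators. Qed.

Lemma j1_funM : {morph j1_fun : x y / x * y}.
Proof. exact: pliftM j1_relators. Qed.

Lemma j0_funE :
  [/\ j0_fun a1 = a3^-1, j0_fun a2 = a2^-1, j0_fun a3 = a1^-1,
      j0_fun a4 = a4^-1 & j0_fun a5 = a5^-1].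
Proof. by split; rewrite /j0_fun (plift_gen j0_relators). Qed.

Lemma j1_funE :
  [/\ j1_fun a1 = a2 * a5^-1, j1_fun a2 = a3 * a5^-1, j1_fun a3 = a4 * a5^-1,
      j1_fun a4 = a1 * a5^-1 & j1_fun a5 = a5^-1].
Proof. by split; rewrite /j1_fun (plift_gen j1_relators). Qed.

Lemma j0_funK : involutive j0_fun.
Proof.
apply: presented_eq => [x y|//|x]; first by rewrite !j0_funM.
have [e1 e2 e3 e4 e5] := j0_funE; have fV := listing_morphV j0_funM.
by case: x; rewrite -/a1 -/a2 -/a3 -/a4 -/a5 ?(e1, e2, e3, e4, e5) fV
  ?(e1, e2, e3, e4, e5) invgK.
Qed.

Lemma j1_funK : cancel j1_fun (j1_fun \o j1_fun \o j1_fun).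
Proof.
apply: presented_eq => [x y|//|x]; first by rewrite /= !j1_funM.
have [e1 e2 e3 e4 e5] := j1_funE; have fV := listing_morphV j1_funM.
have sq : [/\ j1_fun (j1_fun a1) = a3, j1_fun (j1_fun a2) = a4,
    j1_fun (j1_fun a3) = a1, j1_fun (j1_fun a4) = a2
  & j1_fun (j1_fun a5) = a5].
  by split; rewrite ?(e1, e2, e3, e4, e5) ?j1_funM ?fV
    ?(e1, e2, e3, e4, e5) ?invgK ?mulgVK.
have [s1 s2 s3 s4 s5] := sq.
by case: x; rewrite /= -/a1 -/a2 -/a3 -/a4 -/a5 ?(s1, s2, s3, s4, s5).
Qed.

Lemma j0_subproof : is_aut j0_fun.
Proof. by split; [exact: j0_funM | exists j0_fun; exact: j0_funK]. Qed.

Lemma j1_subproof : is_aut j1_fun.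
Proof.
split; first exact: j1_funM.
by exists (j1_fun \o j1_fun \o j1_fun) => x; exact: j1_funK.
Qed.

Definition j0 : autom listing_group := mk_aut j0_subproof.
Definition j1 : autom listing_group := mk_aut j1_subproof.

(* Main.v *)
Require Import Defs.
From HB Require Import structures.
From mathcomp Require Import all_boot all_algebra zify ring.
From mathcomp Require Import boolp classical_sets.

(** The elements of degree zero of the group form a free group F of rank two,
    the group of the fibre of the knot complement: with t = a1 and
    x = a3 a1^-1, the relations say that t conjugates F, free on x and on the
    quotient y of t x t^-1 by x, through x -> x y, y -> y x y. That F is
    free is seen on the action of the group by automorphisms of a free group
    ([monodromy_incl]), and t generates a complement of it
    ([fiber_decomposition]).

    An automorphism induces 1 or -1 on the abelianisation, which is infinite
    cyclic, and j1 induces -1; so only automorphisms al with al t in F t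
    matter. Such an al preserves F, and on the abelianisation of F it commutes
    with C^2, where C = (0 1; 1 1). Hence it acts there as a unit p + q C of
    the ring of integers of the golden field ([expo_fiber_image],
    [fiber_image_norm]). The group of units is generated by -1 and 1 - C;
    these are the actions of j1^2 and of j0 j1 followed by conjugation by t
    ([golden]). A descent on the unit therefore reduces the theorem to the case
    where al acts trivially on the abelianisation of F ([listed_deg1]).

    In that case al is inner on F by a theorem of Nielsen
    ([nielsen_reduction], [basis_ia_conj]): every generating pair of F becomes,
    after a simultaneous conjugation and changes of sign, a pair of positive
    words in the signed generators, and positive words are determined by their
    exponent sums when these are those of a generator. Once al fixes F
    pointwise, t and al t conjugate F in the same way, and since F has trivial
    centre they are equal ([ia_aut_inner]). *)

Set Implicit Arguments.
Unset Strict Implicit.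
Unset Printing Implicit Defensive.

Import GRing.Theory.
Local Open Scope group_scope.

(** * Rewriting in groups *)

(** Group laws in which every product is read in the group structure itself:
    the library laws produce products read in weaker structures, so that two
    equal words need not be recognised as the same term. *)
Section GroupRewriting.
Variable G : groupType.
Implicit Types x y : G.

Lemma g_mulA x y z : x * (y * z) = x * y * z. Proof. exact: mulgA. Qed.
Lemma g_mulK x y : x * y * y^-1 = x. Proof. exact: mulgK. Qed.
Lemma g_mulVK x y : x * y^-1 * y = x. Proof. exact: mulgVK. Qed.
Lemma g_mulV x : x * x^-1 = 1. Proof. exact: mulgV. Qed.
Lemma g_mulVg x : (x^-1 : G) * x = 1. Proof. exact: mulVg. Qed.
Lemma g_mul1g x : (1 : G) * x = x. Proof. exact: mul1g. Qed.
Lemma g_mulg1 x : x * 1 = x. Proof. exact: mulg1. Qed.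
Lemma g_invK x : (x^-1)^-1 = x. Proof. exact: invgK. Qed.
Lemma g_invM x y : (x * y)^-1 = (y^-1 : G) * x^-1. Proof. exact: invgM. Qed.
Lemma g_inv1 : 1^-1 = 1 :> G. Proof. exact: invg1. Qed.

Definition g_rules :=
  (g_invM, g_invK, g_inv1, g_mulA, g_mulK, g_mulVK, g_mulV, g_mulVg, g_mul1g, g_mulg1).

End GroupRewriting.

Ltac group_simp := rewrite ?g_rules.
Ltac group_exact := group_simp; let H := fresh in intro H; exact H.

Section Morphisms.
Variables (G H : groupType) (f : G -> H).
Hypothesis fM : {morph f : x y / x * y}.

Lemma morph_one : f 1 = 1.
Proof. by apply: (mulgI (f 1)); rewrite -fM !mulg1. Qed.

Lemma morph_inv : {morph f : x / x^-1}.
Proof. by move=> x; apply: (mulgI (f x)); rewrite -fM !mulgV morph_one. Qed.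

End Morphisms.

(** * Reduced words *)

Section ReducedWords.
Variable X : choiceType.
Implicit Types (l : X * bool) (u v w : word X).

Definition inv_letter l : X * bool := (l.1, ~~ l.2).

Lemma inv_letterK : involutive inv_letter.
Proof. by case=> x b; rewrite /inv_letter /= negbK. Qed.

Lemma inv_letter_neq l : (inv_letter l == l) = false.
Proof. by case: l => x b; rewrite /inv_letter xpair_eqE /= eqxx; case: b. Qed.

Definition reduced w : bool := sorted (fun l l' => l' != inv_letter l) w.

(** Left multiplication by a letter, on reduced words. *)
Definition push l w : word X :=
  if w is l' :: w' then if l' == inv_letter l then w' else l :: w else [:: l].

Definition reduce w : word X := foldr push [::] w.

Lemma push_reduced l w : reduced w -> reduced (push l w).
Proof.
case: w => [|l' w] //= Rw; case: ifPn => [_|nl] /=; last by rewrite nl.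
exact: path_sorted Rw.
Qed.

Lemma foldr_push_reduced u w : reduced w -> reduced (foldr push w u).
Proof. by move=> Rw; elim: u => //= l u IHu; apply: push_reduced. Qed.

Lemma reduce_reduced w : reduced (reduce w).
Proof. exact: foldr_push_reduced. Qed.

Lemma pushK l w : reduced w -> push l (push (inv_letter l) w) = w.
Proof.
case: w => [|l' w] /=; first by rewrite eqxx.
rewrite inv_letterK; case: ifPn => [/eqP -> | nl _ /=]; last by rewrite eqxx.
by case: w => [|l2 w] //= /andP[/negbTE -> _].
Qed.

Lemma reduce_id w : reduced w -> reduce w = w.
Proof.
elim: w => //= l w IHw Rw; rewrite IHw; last exact: path_sorted Rw.
by case: w {IHw} Rw => //= l' w /andP[/negbTE -> _].
Qed.

(** Letters act on the set of reduced words by [push], inverse letters by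
    inverse permutations; equivalent words therefore act alike. Applied to the
    empty word this makes the reduced form an invariant. *)
Lemma weq_foldr_push u v :
  weq [::] u v -> forall w, reduced w -> foldr push w u = foldr push w v.
Proof.
elim=> {u v} // [u v _ IH w Rw|v u w _ IH1 _ IH2 z Rz|u u' v v' _ IHu _ IHv w Rw|].
- by rewrite IH.
- by rewrite IH1 // IH2.
- by rewrite !foldr_cat IHv // IHu // foldr_push_reduced.
- by move=> x b w Rw /=; apply: (pushK (x, b)).
Qed.

Lemma weq_push l w : weq [::] (push l w) (l :: w).
Proof.
case: w => [|l' w] /=; first exact: weq_refl.
case: ifPn => [/eqP ->|_]; last exact: weq_refl.
apply: weq_sym; rewrite -[_ :: _ :: _]/([:: l; inv_letter l] ++ w) -[X in weq _ _ X]cat0s.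
by apply: weq_cat; [case: l => x b; exact: weq_cancel|exact: weq_refl].
Qed.

Lemma weq_reduce w : weq [::] (reduce w) w.
Proof.
elim: w => [|l w IHw] /=; first exact: weq_refl.
apply: weq_trans (weq_push _ _) _; rewrite -cat1s -(cat1s l w).
by apply: weq_cat => //; exact: weq_refl.
Qed.

Lemma reduced_wordV w : reduced (wordV w) = reduced w.
Proof.
rewrite /reduced /wordV rev_sorted sorted_map; apply: eq_sorted => l l' /=.
by rewrite -/(inv_letter l) -/(inv_letter l') inv_letterK eq_sym.
Qed.

Fixpoint lcp u v : nat :=
  match u, v with
  | l :: u', l' :: v' => if l == l' then (lcp u' v').+1 else 0
  | _, _ => 0
  end.

Lemma leq_lcp k u v :
  (k <= lcp u v) = [&& k <= size u, k <= size v & take k u == take k v].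
Proof.
elim: u v k => [|l u IHu] [|l' v] [|k] //=.
  by rewrite ltnS andbF.
case: (eqVneq l l') => [<-|nl]; first by rewrite ltnS IHu !ltnS eqseq_cons eqxx.
by rewrite ltn0 eqseq_cons (negbTE nl) !andbF.
Qed.

Lemma lcp_drop u v : lcp (drop (lcp u v) u) (drop (lcp u v) v) = 0.
Proof. by elim: u v => [|l u IHu] [|l' v] //=; case: ifPn => //= /negbTE ->. Qed.

End ReducedWords.

(** * Free groups and the lengths of their elements *)

Section FreeGroup.
Variable X : choiceType.

Definition free_group : groupType := presented ([::] : seq (word X)).
Implicit Types (x y z g : free_group) (w : word X).

Definition free_gen (c : X) : free_group := pgen [::] c.

Lemma free_relators (H : groupType) (f : X -> H) (r : word X) :
  r \in [::] -> eval_word f r = 1.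
Proof. by []. Qed.

Definition nf g : word X := reduce (prepr g).

Lemma nf_class w : nf (pclass [::] w) = reduce w.
Proof.
rewrite /nf /reduce; apply: weq_foldr_push => //.
by apply/pclassP; rewrite preprK.
Qed.

Lemma nf_reduced g : reduced (nf g).
Proof. exact: reduce_reduced. Qed.

Lemma nfK g : pclass [::] (nf g) = g.
Proof. by rewrite -[RHS]preprK; apply/pclassP/weq_reduce. Qed.

Lemma nfE w : reduced w -> nf (pclass [::] w) = w.
Proof. by move=> Rw; rewrite nf_class reduce_id. Qed.

Lemma nfV g : nf g^-1 = wordV (nf g).
Proof. by rewrite -{1}(nfK g) -pclass_wordV nfE // reduced_wordV nf_reduced. Qed.

Lemma nf1 : nf 1 = [::].
Proof. exact: (nfE (w := [::])). Qed.

Lemma nf_gen c : nf (free_gen c) = [:: pos c].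
Proof. exact: nfE. Qed.

Definition len g : nat := size (nf g).

(** The Gromov product of two vertices of the Cayley tree, seen from the base
    point. *)
Definition overlap x y : nat := lcp (nf x) (nf y).

Lemma len_eq0 g : len g = 0 -> g = 1.
Proof. by move/size0nil => g0; rewrite -(nfK g) g0. Qed.

Lemma lenV g : len g^-1 = len g.
Proof. by rewrite /len nfV size_rev size_map. Qed.

Lemma len1 : len 1 = 0. Proof. by rewrite /len nf1. Qed.

Lemma len_gen c : len (free_gen c) = 1%N.
Proof. by rewrite /len nf_gen. Qed.

(** The common prefix of the normal forms is exactly what cancels in x^-1 y:
    past it the first letters differ. *)
Lemma overlap_len x y : (2 * overlap x y + len ((x^-1 : free_group) * y)%g = len x + len y)%N.
Proof.
rewrite /overlap /len; set s := nf x; set t := nf y; set k := lcp s t.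
have /and3P[ks kt /eqP eq_take] : [&& k <= size s, k <= size t & take k s == take k t].
  by rewrite -leq_lcp.
have Rs : reduced (drop k s) by apply: drop_sorted; exact: nf_reduced.
have Rt : reduced (drop k t) by apply: drop_sorted; exact: nf_reduced.
have -> : (x^-1 : free_group) * y = pclass [::] (wordV (drop k s) ++ drop k t).
  rewrite -(nfK x) -(nfK y) -/s -/t -{1}(cat_take_drop k s) -{1}(cat_take_drop k t).
  by rewrite !pclassM pclass_wordV eq_take invgM -mulgA mulKg.
rewrite nfE.
  by rewrite size_cat size_rev size_map !size_drop; lia.
have := lcp_drop s t; rewrite -/k; rewrite -reduced_wordV in Rs.
case: (drop k s) Rs => [|l s'] Rs; first by [].
case: (drop k t) Rt => [|l' t'] Rt; first by rewrite cats0.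
rewrite /=; case: ifPn => // ll' _.
move: Rs; rewrite /reduced /wordV /= rev_cons; case: (rev _) => [_|l2 s2] /=.
  rewrite (_ : (l.1, ~~ l.2) = inv_letter l) // inv_letterK eq_sym ll'; exact: Rt.
rewrite rcons_path => /andP[Rs sl]; rewrite cat_path rcons_path Rs sl /=.
by rewrite last_rcons (_ : (l.1, ~~ l.2) = inv_letter l) // inv_letterK eq_sym ll'; exact: Rt.
Qed.

Lemma overlap_lenV x y : (2 * overlap x^-1%g y + len (x * y)%g = len x + len y)%N.
Proof. by rewrite -(lenV x) -overlap_len invgK. Qed.

Lemma overlap_lenM x y : (2 * overlap x (x * y)%g + len y = len x + len (x * y)%g)%N.
Proof. by rewrite -overlap_len mulKg. Qed.

Lemma overlap_le x y : overlap x y <= len x.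
Proof. by have := leqnn (lcp (nf x) (nf y)); rewrite leq_lcp => /and3P[]. Qed.

(** The tree inequality, which says that the space is 0-hyperbolic. *)
Lemma overlap_trans k x y z :
  k <= overlap x y -> k <= overlap y z -> k <= overlap x z.
Proof.
rewrite /overlap !leq_lcp => /and3P[-> _ /eqP ->] /and3P[_ -> /eqP ->].
by rewrite eqxx.
Qed.

Lemma overlapC x y : overlap x y = overlap y x.
Proof.
by apply/eqP; rewrite eqn_leq; apply/andP; split; rewrite leq_lcp andbCA;
  rewrite [_ == _]eq_sym -leq_lcp.
Qed.

Lemma prefix_exists k x : k <= len x -> exists2 q, len q = k & overlap q x = k.
Proof.
move=> kx; exists (pclass [::] (take k (nf x))).
  by rewrite /len nfE ?size_takel //; apply: take_sorted; exact: nf_reduced.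
rewrite /overlap nfE; last by apply: take_sorted; exact: nf_reduced.
apply/eqP; rewrite eqn_leq; apply/andP; split.
  have := leqnn (lcp (take k (nf x)) (nf x)).
  by rewrite leq_lcp size_takel // => /andP[].
by rewrite leq_lcp take_takel // eqxx size_takel // leqnn kx.
Qed.

(** If half of g cancelled in g g, the letters of its reduced word in mirror
    positions would be inverse to each other: the middle letter would be its
    own inverse, or the two middle letters would cancel. *)
Lemma overlapV g : g <> 1%g -> (2 * overlap g^-1%g g < len g)%N.
Proof.
move=> g1; rewrite ltnNge; apply/negP => le_g.
have {g1} n0 : 0 < len g by case: (posnP (len g)) => // /len_eq0.
set s := nf g in le_g n0; set k := overlap g^-1 g in le_g.
have /and3P[_ ks /eqP eq_take] :
    [&& k <= size (nf g^-1), k <= size s & take k (nf g^-1) == take k s].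
  by rewrite -leq_lcp.
have l0 : X * bool by move: n0; rewrite /len; case: (nf g).
have sym i : i < k -> nth l0 s i = inv_letter (nth l0 s (size s - i.+1)).
  move=> ik; rewrite -(nth_take l0 ik) -eq_take nth_take // nfV /wordV -/s.
  by rewrite nth_rev size_map ?(nth_map l0) //; lia.
have Rs : reduced s := nf_reduced g.
have size_s : size s = len g by [].
case: (boolP (odd (size s))) => os.
  have := sym (size s)./2; rewrite (_ : size s - _ = (size s)./2); last by lia.
  by move/(_ ltac:(lia))/esym/eqP; rewrite inv_letter_neq.
have := sym ((size s)./2.-1); rewrite (_ : size s - _ = (size s)./2); last by lia.
move/(_ ltac:(lia)) => e.
have /(sortedP l0)/(_ (size s)./2.-1) := Rs.
by rewrite prednK; [rewrite e inv_letterK eqxx; lia|lia].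
Qed.

End FreeGroup.

Section Center.
Variables (X : choiceType) (c1 c2 : X).

(** Let c be one of the two generators that is not the first letter of f. Then
    c and f have no common prefix, neither do c^-1 and f, so that c f is longer
    than f and starts with c; but f c = c f starts with f. *)
Lemma center_free (f : free_group X) : c1 != c2 ->
  commute f (free_gen c1) -> commute f (free_gen c2) -> f = 1.
Proof.
move=> c12 f1 f2; apply: contrapT => fn1.
have n0 : 0 < len f by case: (posnP (len f)) => // /len_eq0.
have [l [s fE]] : exists l s, nf f = l :: s.
  by move: n0; rewrite /len; case: (nf f) => // l s; exists l, s.
have [c lc fc] : exists2 c, l.1 != c & commute f (free_gen c).
  by case: (eqVneq l.1 c1) => [->|]; [exists c2|exists c1].
set y := free_gen c in fc; have {}fc : f * y = y * f := fc.
have o1 : overlap y f = 0.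
  rewrite /overlap nf_gen fE /= (_ : (pos c == l) = false) //.
  by apply/eqP=> e; rewrite -e eqxx in lc.
have o2 : overlap y^-1 f = 0.
  rewrite /overlap nfV nf_gen fE /= (_ : (_ == l) = false) //.
  by apply/eqP=> e; rewrite -e eqxx in lc.
have := overlap_lenV y f; have := overlap_lenM f y; have := overlap_lenM y f.
rewrite len_gen o2 fc => e1 e2 e3.
have of_yf : 1 <= overlap f (y * f) by lia.
have oyf_y : 1 <= overlap (y * f) y by rewrite overlapC; lia.
by have := overlap_trans of_yf oyf_y; rewrite overlapC o1.
Qed.

End Center.

(** * Generating pairs *)

Section Generation.
Variable G : groupType.
Implicit Types u v g : G.

Definition generates u v : Prop := generated [set u; v]%classic = setT.

Lemma generatesP u v : generates u v <->
  forall S : set G, subgroup S -> S u -> S v -> forall g, S g.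
Proof.
split=> [uv S SS Su Sv g|uv].
  have /(_ g) : (generated [set u; v] `<=` S)%classic.
    by apply: smallest_sub => // x [->|->].
  by apply; rewrite uv.
apply/seteqP; split=> // g _ S /= [SS uvS].
by apply: uv => //; apply: uvS; [left|right].
Qed.

Lemma generates_sub u v u' v' : generates u v ->
  (forall S : set G, subgroup S -> S u' -> S v' -> S u /\ S v) ->
  generates u' v'.
Proof.
move=> /generatesP uv sub; apply/generatesP => S SS Su Sv.
by have [] := sub S SS Su Sv; apply: uv.
Qed.

Lemma generates_conj g u v :
  generates u v -> generates (g * u * g^-1) (g * v * g^-1).
Proof.
move=> /generatesP uv; apply/generatesP => S /subgroupP[S1 SM SV] Su Sv h.
have /uv : subgroup [set x | S (g * x * g^-1)]%classic.
  apply/subgroupP; split=> /= [|x y Sx Sy|x Sx].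
  - by rewrite mulg1 mulgV.
  - by have := SM _ _ Sx Sy; group_simp.
  - by have := SV _ Sx; group_simp.
by move=> /(_ Su Sv (g^-1 * h * g)) /=; group_simp.
Qed.

End Generation.

(** * Christoffel bases of the free group of rank two *)

Section ChristoffelBases.

Notation F2 := (free_group bool).
Implicit Types (u v g : F2) (b c d e : bool).

Definition signed (G : groupType) b (x : G) : G := if b then x^-1 else x.

Lemma signedK (G : groupType) b : involutive (@signed G b).
Proof. by case: b => x /=; rewrite ?invgK. Qed.

Lemma signed_conj (G : groupType) b (g x : G) :
  signed b (g * x * g^-1) = g * signed b x * g^-1.
Proof. by case: b => //=; group_simp. Qed.

(** The pairs obtained from two signed generators by positive transvections.
    Such pairs consist of positive words in the signed generators, and are the
    analogue in the free group of the Christoffel words. *)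
Inductive christoffel : F2 -> F2 -> Prop :=
| christoffel_gen c d d' :
    christoffel (signed d (free_gen c)) (signed d' (free_gen (~~ c)))
| christoffel_L u v : christoffel u v -> christoffel (u * v) v
| christoffel_R u v : christoffel u v -> christoffel u (v * u).

Definition christoffel_basis u v : Prop :=
  exists g e e', christoffel (signed e (g * u * g^-1)) (signed e' (g * v * g^-1)).

Lemma christoffel_sym u v : christoffel u v -> christoffel v u.
Proof.
elim=> {u v} [c d d'|u v _|u v _]; [|exact: christoffel_R|exact: christoffel_L].
by rewrite -{2}(negbK c); exact: christoffel_gen.
Qed.

Lemma basis_conj g u v :
  christoffel_basis u v -> christoffel_basis (g * u * g^-1) (g * v * g^-1).
Proof. by case=> h [e [e' P]]; exists (h * g^-1), e, e'; move: P; group_simp. Qed.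

Lemma basis_signed d d' u v :
  christoffel_basis u v -> christoffel_basis (signed d u) (signed d' v).
Proof.
case=> h [e [e' P]]; exists h, (d (+) e), (d' (+) e'); rewrite -!signed_conj.
move: P; move: (h * u * _) (h * v * _) => x y.
by case: d d' e e' => [] [] [] []; rewrite /= ?invgK.
Qed.

Lemma basis_sym u v : christoffel_basis u v -> christoffel_basis v u.
Proof. by case=> h [e [e' P]]; exists h, e', e; exact: christoffel_sym. Qed.

Lemma christoffel_is_basis u v : christoffel u v -> christoffel_basis u v.
Proof. by exists 1, false, false; rewrite /= invg1 !mulg1 !mul1g. Qed.

(** Dividing by the second entry undoes the last transvection; if that
    transvection changed v into v u, the quotient is v^-1, and (v, v u) is
    conjugate to the pair (v, u v). *)
Lemma basis_mulVr_christoffel u v :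
  christoffel u v -> christoffel_basis (u * v^-1) v.
Proof.
case=> {u v} [c d d'|u v uv|u v uv].
- have := christoffel_L (christoffel_gen c d (~~ d')).
  move/christoffel_is_basis/(basis_signed false true).
  by case: d'; rewrite /= ?invgK.
- by rewrite mulgK; exact: christoffel_is_basis.
- move: (christoffel_R (christoffel_sym uv)).
  by move/christoffel_is_basis/(basis_conj v)/(basis_signed true false); rewrite /=; group_exact.
Qed.

(** Together with inversions and exchange, this makes the class of pairs that
    are Christoffel up to signs and conjugation stable under all Nielsen moves.
    *)
Lemma basis_mul u v : christoffel_basis u v -> christoffel_basis (u * v) v.
Proof.
move=> [g [e [e' uv]]].
suff : christoffel_basis (g * u * g^-1 * (g * v * g^-1)) (g * v * g^-1).
  by move/(basis_conj g^-1); group_exact.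
move: uv; rewrite -{2}(signedK e (g * u * _)) -{2 3}(signedK e' (g * v * _)).
move: (signed e _) (signed e' _) => p q pq.
have pq1 := christoffel_is_basis (christoffel_L pq).
have pq2 := basis_mulVr_christoffel pq.
case: e e' => [] [] //=.
- by have := basis_signed true true (basis_conj q pq1); rewrite /=; group_exact.
- by have := basis_signed true false (basis_conj q^-1 pq2); rewrite /=; group_exact.
- exact: (basis_signed false true pq2).
Qed.

Lemma basis_mul_inv u v : christoffel_basis (u * v) v -> christoffel_basis u v.
Proof.
move/(basis_signed false true)/basis_mul/(basis_signed false true).
by rewrite /= invgK mulgK.
Qed.

End ChristoffelBases.

(** * Nielsen reduction *)

Section NielsenReduction.

Notation F2 := (free_group bool).

Definition pair_fun (G : groupType) (u v : G) (c : bool) : G := if c then v else u.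

(** A pair (u, v) whose total length cannot be lowered by a Nielsen move
    followed by a simultaneous conjugation. Then no letter of a reduced word in
    u and v is absorbed by the cancellations with its two neighbours. *)
Section MinimalPair.
Variables u v : F2.
Hypotheses (u1 : u <> 1) (v1 : v <> 1).

Notation X := (eval_letter (pair_fun u v)).
Notation W := (eval_word (pair_fun u v)).
Implicit Types (l : bool * bool) (w : word bool).

Hypothesis uv_min : forall l l', l.1 != l'.1 -> forall g,
  len u + len v <= len (g * X l' * g^-1) + len (g * (X l * X l') * g^-1).

Let d l l' := overlap (X l)^-1 (X l').

Lemma X_inv_letter l : X (inv_letter l) = (X l)^-1.
Proof. by case: l => c [] /=; rewrite /eval_letter /= ?invgK. Qed.

Lemma X_neq1 l : X l <> 1.
Proof.
by case: l => [] [] []; rewrite /eval_letter /= => // /(congr1 (fun x => x^-1));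
  rewrite invgK invg1.
Qed.

Lemma len_X l : len (X l) = len (pair_fun u v l.1).
Proof. by case: l => c []; rewrite /eval_letter /= ?lenV. Qed.

Lemma len_X2 l l' : l.1 != l'.1 -> len (X l) + len (X l') = len u + len v.
Proof. by rewrite !len_X; case: l l' => [] [] b [] [] b' //= _; rewrite addnC. Qed.

Lemma same_letter l l' : l' != inv_letter l -> l.1 = l'.1 -> l' = l.
Proof.
by case: l l' => c b [c' b'] /= + e; rewrite -{}e xpair_eqE eqxx; case: b b' => [] [].
Qed.

Lemma self_overlap l : (2 * d l l < len (X l))%N.
Proof. exact/overlapV/X_neq1. Qed.

Lemma cancel_half l l' : l' != inv_letter l ->
  (2 * d l l' <= len (X l))%N /\ (2 * d l l' <= len (X l'))%N.
Proof.
move=> ll'; case: (eqVneq l.1 l'.1) => [e|ne].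
  by rewrite (same_letter ll' e); split; apply: ltnW; apply: self_overlap.
have := uv_min ne 1; have ne' : (inv_letter l').1 != (inv_letter l).1 by rewrite eq_sym.
have := uv_min ne' 1; rewrite -(len_X2 ne) !X_inv_letter invg1 !mul1g !mulg1 -g_invM !lenV.
have := overlap_lenV (X l) (X l'); rewrite -/(d l l'); lia.
Qed.

(** If V is half cancelled by U on both sides, write V = p q^-1 and U = q U'
    p^-1. Conjugation by q^-1 sends V to q^-1 p, which is not longer than V,
    and U V to U', which is shorter than U. *)
Lemma cancel_conj l l' : l.1 != l'.1 ->
  (2 * d l l' = len (X l'))%N -> (2 * d l' l = len (X l'))%N ->
  (2 * d l l' <= len (X l))%N -> False.
Proof.
move=> ne; have := X_neq1 (l := l'); have := len_X2 ne; have := uv_min ne.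
rewrite /d; set U := X l; set V := X l'; set k := overlap U^-1 V.
move=> minUV lenUV V1 kV; rewrite -kV => kV' kU.
have k0 : 0 < k by case: (posnP k) => // k0; case: V1; apply: len_eq0; lia.
(* V = p q^-1 with both halves of length k, and p = V q. *)
have [|q lq oq] := @prefix_exists _ k V^-1; first by rewrite lenV; lia.
have lVq : len (V * q) = k.
  by have := overlap_len q V^-1; rewrite -g_invM !lenV; lia.
have lqVq := overlap_len q (V * q).
have oV : overlap V (V * q) = k by have := overlap_lenM V q; lia.
have oU : k <= overlap U^-1 (V * q).
  by apply: (overlap_trans (y := V)); rewrite ?oV.
have lUp := overlap_lenV U (V * q).
have oUp := overlap_le (V * q) U^-1; rewrite overlapC in oUp.
(* U starts with q and ends with p^-1, and is long enough for both. *)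
have oUU : k <= overlap U (U * (V * q)).
  by have := overlap_lenM U (V * q); lia.
have oqU : k <= overlap q U by apply: (overlap_trans (y := V^-1)); lia.
have oqUp : k <= overlap q (U * (V * q)) := overlap_trans oqU oUU.
have lqUp := overlap_len q (U * (V * q)).
have := minUV q^-1; rewrite g_invK -!g_mulA; lia.
Qed.

(** If the cancellations used up X l', each would have to be half of it. This
    excludes l = l' and l'' = l', since by [overlapV] less than half of X l'
    cancels in its square. When l and l'' are inverse letters, X l' and its
    inverse would share their first half; when they are equal, [cancel_conj]
    applies. *)
Lemma cancel_lt l l' l'' : l' != inv_letter l -> l'' != inv_letter l' ->
  d l l' + d l' l'' < len (X l').
Proof.
move=> ll' l'l''; rewrite ltnNge; apply/negP => le_d.
have [d1 d2] := cancel_half ll'; have [d3 d4] := cancel_half l'l''.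
have e1 : (2 * d l l' = len (X l'))%N by lia.
have e2 : (2 * d l' l'' = len (X l'))%N by lia.
have ne1 : l.1 != l'.1.
  by apply/eqP => /(same_letter ll') e; have := self_overlap l; rewrite -e in e1 *; lia.
have ne2 : l'.1 != l''.1.
  by apply/eqP => /(same_letter l'l'') e; have := self_overlap l'; rewrite e in e2 *; lia.
case: (eqVneq l'' (inv_letter l)) => [e|ne].
  have V1 : (X l')^-1 <> 1 by rewrite -X_inv_letter; exact: X_neq1.
  have := overlapV V1; rewrite lenV invgK overlapC.
  suff : d l l' <= overlap (X l')^-1 (X l') by lia.
  apply: (overlap_trans (y := (X l)^-1)) => //.
  by rewrite -(X_inv_letter l) -e -/(d l' l''); lia.
have {ne} e : l'' = l.
  apply: same_letter => //.
  by move: ne1 ne2; case: (l.1) (l'.1) (l''.1) => [] [] [].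
by apply: (cancel_conj ne1 e1 _ d1); rewrite -e.
Qed.

(** By the strict inequality of [cancel_lt] the overlap with a preceding letter
    depends only on the first letter of the word, so that cancellations stay
    local and every letter contributes at least one to the length. *)
Lemma len_reduced_cons l w : reduced (l :: w) -> forall l0, l != inv_letter l0 ->
  overlap (X l0)^-1 (W (l :: w)) = d l0 l /\ (size w).+1 + d l0 l <= len (W (l :: w)).
Proof.
have W_cons l' w' : W (l' :: w') = X l' * W w' by rewrite /eval_word big_cons.
elim: w l => [|l1 w IHw] l Rw l0 ll0.
  have ll : l != inv_letter l by rewrite eq_sym inv_letter_neq.
  have := cancel_lt ll0 ll.
  by rewrite W_cons /eval_word big_nil mulg1 -/(d l0 l); split=> //=; lia.
have [ll1 {}Rw] : l1 != inv_letter l /\ reduced (l1 :: w) by move: Rw => /= /andP[].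
have [ov le_w] := IHw l1 Rw l ll1; rewrite W_cons.
set P := W _ in ov le_w *.
have := overlap_lenV (X l) P; rewrite ov => lenXP.
have ovX := overlap_lenM (X l) P.
have lt_d := cancel_lt ll0 ll1; split; last by rewrite /=; set n := size w in le_w *; lia.
apply/eqP; rewrite eqn_leq; apply/andP; split.
  rewrite leqNgt; apply/negP => lt_ov.
  have := @overlap_trans _ (d l0 l).+1 _ _ (X l) lt_ov.
  by rewrite overlapC -/(d l0 l) => /(_ ltac:(lia)); lia.
by apply: (overlap_trans (y := X l)); rewrite -/(d l0 l); lia.
Qed.

Lemma len_reduced w : reduced w -> size w <= len (W w).
Proof.
case: w => [|l w] // Rw.
have [|_] := len_reduced_cons Rw (l0 := l); first by rewrite eq_sym inv_letter_neq.
by move=> /=; lia.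
Qed.

Lemma generates_word : generates u v -> forall f, exists2 w, reduced w & f = W w.
Proof.
move/generatesP => uv; apply: uv.
- pose lift : F2 -> F2 := plift (pair_fun u v).
  have liftM : {morph lift : x y / x * y}.
    exact: pliftM (free_relators (pair_fun u v)).
  have liftW g : lift g = W (nf g).
    by rewrite -{1}(nfK g) /lift (plift_class (free_relators _)).
  have ex g : exists2 w, reduced w & lift g = W w.
    by exists (nf g); [exact: nf_reduced|exact: liftW].
  have onto w : exists g, W w = lift g.
    by exists (pclass [::] w); rewrite /lift (plift_class (free_relators _)).
  apply/subgroupP; split=> /= [|x y [w _ ->] [w' _ ->]|x [w _ ->]].
  + by rewrite -(morph_one liftM).
  + by have [[g ->] [h ->]] := (onto w, onto w'); rewrite -liftM.
  + by have [g ->] := onto w; rewrite -(morph_inv liftM).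
- by exists [:: pos false]; rewrite // /eval_word big_seq1.
- by exists [:: pos true]; rewrite // /eval_word big_seq1.
Qed.

(** Each free generator has length one, so by [len_reduced] it is a word of one
    letter in u and v. *)
Lemma minimal_basis : generates u v -> christoffel_basis u v.
Proof.
move=> uv; have gen_X c : exists l, free_gen c = X l.
  have [w Rw e] := generates_word uv (free_gen c).
  have := len_reduced Rw; rewrite -e len_gen => sw.
  case: w sw Rw e => [|l [|//]] _ _; last by exists l; rewrite e /eval_word big_seq1.
  by rewrite /eval_word big_nil => e; have := len_gen c; rewrite e len1.
have [[l el] [l' el']] := (gen_X false, gen_X true).
have gen_signed m : pair_fun u v m.1 = signed m.2 (X m).
  by case: m => c []; rewrite /eval_letter /= ?invgK.
have ne : l.1 != l'.1.
  apply/eqP => e; have := gen_signed l; have := gen_signed l'.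
  rewrite e -el -el' => -> /(congr1 (fun g => nf g)).
  by case: (l.2) (l'.2) => [] []; rewrite /= ?nfV !nf_gen.
move: (gen_signed l) (gen_signed l') ne; rewrite -el -el'.
case: (l.1) (l'.1) => [] [] //= -> -> _.
  exact/basis_sym/christoffel_is_basis/(christoffel_gen false).
exact/christoffel_is_basis/(christoffel_gen false).
Qed.

End MinimalPair.

(** The free group of rank two is not abelian, hence not cyclic. *)
Lemma generates_neq1 (u v : F2) : generates u v -> u <> 1.
Proof.
move=> uv u1; move: uv; rewrite {}u1 => /generatesP uv.
(* v lies in the centraliser of v, so it commutes with the whole group; then
   every centraliser contains v and is the whole group. *)
have cent (x : F2) : subgroup [set f | commute x f]%classic.
  by apply/subgroupP; split=> /=; [exact: commute1|exact: commuteM|exact: commuteV].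
have commv f : commute v f := uv _ (cent v) (commute1 v) (commute_refl v) f.
have comm f g : commute f g :=
  uv _ (cent f) (commute1 f) (commute_sym (commv f)) g.
have := len_gen false; rewrite (_ : free_gen false = 1) ?len1 //.
exact: (@center_free _ false true).
Qed.

Lemma generates_sym (G : groupType) (u v : G) : generates u v -> generates v u.
Proof. by move=> uv; apply: (generates_sub uv). Qed.

(** Induction on the total length: a Nielsen move that lowers it preserves both
    generation and the conclusion, and [minimal_basis] treats the remaining
    pairs. *)
Lemma nielsen_reduction (u v : F2) : generates u v -> christoffel_basis u v.
Proof.
move: {2}(len u + len v).+1 (ltnSn (len u + len v)) => n.
elim: n u v => // n IHn u v le_n uv.
pose X := eval_letter (pair_fun u v).
have [[l [l' [g [ne lt_uv]]]]|min_uv] := pselect (exists l l' g, l.1 != l'.1 /\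
    len (g * X l' * g^-1) + len (g * (X l * X l') * g^-1) < len u + len v).
  have XX : generates (X l') (X l * X l').
    apply: (generates_sub uv) => S /subgroupP[S1 SM SV] S1' S2'.
    have SX1 : S (X l) by rewrite -(mulgK (X l') (X l)); apply: SM => //; apply: SV.
    have SX m : S (X m) -> S (pair_fun u v m.1).
      by case: m => c [] // /SV; rewrite /X /eval_letter /= invgK.
    by move: ne (SX l SX1) (SX l' S1'); case: (l.1) (l'.1) => [] [].
  (* The pair (X l', X l X l') conjugated by g is shorter. *)
  have := IHn _ _ _ (generates_conj g XX); rewrite addnC in lt_uv.
  rewrite addnC in lt_uv; move=> /(_ ltac:(lia))/(basis_conj g^-1); group_simp.
  move/basis_sym/basis_mul_inv/(basis_signed l.2 l'.2).
  rewrite /X /eval_letter -!/(signed _ _) !signedK.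
  by move: ne; case: (l.1) (l'.1) => [] [] //= _ /basis_sym.
apply: minimal_basis => //.
- exact: generates_neq1 uv.
- exact: generates_neq1 (generates_sym uv).
- move=> l l' ne g; rewrite leqNgt; apply/negP => lt_uv.
  by apply: min_uv; exists l, l', g.
Qed.

End NielsenReduction.

Lemma presented_subgroup (X : choiceType) (R : seq (word X))
    (S : set (presented R)) :
  subgroup S -> (forall x, S (pgen R x)) -> forall g, S g.
Proof.
move=> /subgroupP[S1 SM SV] Sgen g; rewrite -(preprK g) -eval_pgen.
rewrite /eval_word; elim/big_ind: _ => // -[x b] _; rewrite /eval_letter /=.
by case: b => //; apply: SV.
Qed.

(** * Exponent sums *)

(** The additive group of the integers as a multiplicatively written group, so
    that homomorphisms to it are obtained from the universal property. *)
Definition addint : Type := int.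
HB.instance Definition _ := Choice.on addint.
HB.instance Definition _ := isGroup.Build addint
  (@addrA int) (@add0r int) (@addr0 int) (@addNr int) (@addrN int).

Section Exponents.
Variable X : choiceType.
Implicit Types f g : free_group X.

Definition expo_gen (c x : X) : addint := if x == c then 1%R else 0%R.

Definition expo (c : X) (f : free_group X) : int := plift (expo_gen c) f.

Lemma expoM c f g : expo c (f * g) = (expo c f + expo c g)%R.
Proof. exact: (pliftM (free_relators (expo_gen c))). Qed.

Lemma expo1 c : expo c 1 = 0%R.
Proof. by have := expoM c 1 1; rewrite mulg1; lia. Qed.

Lemma expoV c f : expo c f^-1 = (- expo c f)%R.
Proof. by have := expoM c f^-1 f; rewrite mulVg expo1; lia. Qed.

Lemma expo_free_gen c x : expo c (free_gen x) = if x == c then 1%R else 0%R.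
Proof. exact: (plift_gen (free_relators (expo_gen c))). Qed.

End Exponents.

Notation F2 := (free_group bool).

Lemma christoffel_positive (u v : F2) : christoffel u v ->
  exists (d : bool -> bool) (s s' : seq bool),
    u = \prod_(c <- s) signed (d c) (free_gen c) /\
    v = \prod_(c <- s') signed (d c) (free_gen c).
Proof.
elim=> {u v} [c d d'|u v _ [d [s [s' [-> ->]]]]|u v _ [d [s [s' [-> ->]]]]].
- exists (fun x => if x == c then d else d'), [:: c], [:: ~~ c].
  by rewrite !big_seq1 eqxx; case: c.
- by exists d, (s ++ s'), s'; rewrite big_cat.
- by exists d, s, (s' ++ s); rewrite big_cat.
Qed.

Lemma expo_positive (d : bool -> bool) (s : seq bool) (c : bool) :
  expo c (\prod_(x <- s) signed (d x) (free_gen x) : F2) =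
  (if d c then - (count_mem c s)%:Z else (count_mem c s)%:Z)%R.
Proof.
elim: s => [|x s IHs]; first by rewrite big_nil expo1; case: (d c).
rewrite big_cons expoM IHs /signed.
have -> : expo c (if d x then (free_gen x)^-1 else free_gen x : F2) =
    (if d x then - (x == c)%:Z else (x == c)%:Z)%R.
  by case: (d x); rewrite ?expoV expo_free_gen; case: (x == c).
rewrite /=; case: (eqVneq x c) => [->|_]; [case: (d c)|case: (d c); case: (d x)]; lia.
Qed.

Lemma positive_gen (d : bool -> bool) (s : seq bool) (c : bool) :
  let w : F2 := \prod_(x <- s) signed (d x) (free_gen x) in
  (`|expo c w|%N = 1)%N -> expo (~~ c) w = 0%R ->
  w = signed (d c) (free_gen c) /\ (expo c w < 0)%R = d c.
Proof.
rewrite /= !expo_positive => c1 c0.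
have {}c1 : count_mem c s = 1%N by move: c1; case: (d c); lia.
have {}c0 : count_mem (~~ c) s = 0%N by move: c0; case: (d (~~ c)); lia.
split; last by rewrite c1; case: (d c).
suff -> : s = [:: c] by rewrite big_seq1.
have : size s = 1%N.
  rewrite -(count_predC (pred1 c)) c1 (_ : count _ s = 0%N) // -[RHS]c0.
  by apply: eq_count => x /=; case: x c {c0 c1} => [] [].
by case: s c1 {c0} => [|x [|//]] //=; case: eqP => // ->.
Qed.

(** A conjugate of a Christoffel basis consists of signed positive words, and a
    positive word with the exponent sums of a generator is that generator. *)
Lemma basis_ia_conj (u v : F2) : christoffel_basis u v ->
  expo false u = 1%R -> expo true u = 0%R ->
  expo false v = 0%R -> expo true v = 1%R ->
  exists g : F2, g * u * g^-1 = free_gen false /\ g * v * g^-1 = free_gen true.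
Proof.
move=> [g [e [e' /christoffel_positive[d [s [s' [us vs]]]]]]] u0 u1 v0 v1.
have expo_signed c b (x : F2) : expo c (signed b (g * x * g^-1)) =
    (if b then - expo c x else expo c x)%R.
  by case: b; rewrite /= ?expoV !expoM !expoV; lia.
have unsign b c (x : F2) (r : seq bool) :
    signed b (g * x * g^-1) = \prod_(y <- r) signed (d y) (free_gen y) ->
    expo c x = 1%R -> expo (~~ c) x = 0%R -> g * x * g^-1 = free_gen c.
  move=> xr x1 x0.
  have [||e1 e2] := @positive_gen d r c; rewrite -?xr ?expo_signed ?x1 ?x0; try by case: b {xr}.
  have <- : signed b (signed (d c) (free_gen c)) = free_gen c :> F2.
    by move: e2; rewrite -xr expo_signed x1; case: b {xr} => /= <-; rewrite ?g_invK.
  by rewrite -e1 -xr signedK.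
by exists g; split; [apply: (unsign e false _ s)|apply: (unsign e' true _ s')].
Qed.

Lemma inner_inj : injective (@inner F2).
Proof.
move=> f g fg; apply: (mulgI g^-1); rewrite mulVg.
suff comm x : commute (g^-1 * f) x by apply: (@center_free _ false true).
have /(congr1 (fun h : autom F2 => g^-1 * h x * f)) := fg.
by rewrite /commute /=; group_exact.
Qed.

(** With t = a1 and x = a3 a1^-1 the defining relations of the group reduce to
    the left-hand equation. Read through y, the quotient of t x t^-1 by x, it
    says how t conjugates y. The lemma serves in both directions, to compute in
    the group and to construct a representation of it. *)
Lemma monodromy_relation (H : groupType) (t x y : H) : t * x = x * y * t ->
  t * x * x * t = x * t * x^-1 * t * x <-> t * y = y * x * y * t.
Proof.
move=> tx; have -> : y = x^-1 * (t * x * t^-1) by rewrite tx; group_simp.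
split=> e.
  by have := congr1 (fun z => x^-1 * z * t^-1) e; group_simp => <-; group_simp.
by have := congr1 (fun z => x * z * t) e; group_simp => ->.
Qed.

Definition fa : F2 := free_gen false.
Definition fb : F2 := free_gen true.

(** * The monodromy of the fibre *)

Lemma free_lift_gen (H : groupType) (f : bool -> H) c :
  plift f (free_gen c) = f c.
Proof. exact: (plift_gen (free_relators f)). Qed.

Lemma free_liftM (H : groupType) (f : bool -> H) :
  {morph (plift f : F2 -> H) : x y / x * y}.
Proof. exact: (pliftM (free_relators f)). Qed.

(** Conjugation by a1 on the fibre, in the basis [fa], [fb]; on exponent sums
    it is the square of the matrix (0 1; 1 1). *)
Definition phi : F2 -> F2 := plift (pair_fun (fa * fb) (fb * fa * fb)).
Definition psi : F2 -> F2 := plift (pair_fun (fa * fa * fb^-1) (fb * fa^-1)).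

Lemma phiM : {morph phi : x y / x * y}. Proof. exact: free_liftM. Qed.
Lemma psiM : {morph psi : x y / x * y}. Proof. exact: free_liftM. Qed.

Lemma phi_a : phi fa = fa * fb. Proof. exact: free_lift_gen. Qed.
Lemma phi_b : phi fb = fb * fa * fb. Proof. exact: free_lift_gen. Qed.
Lemma psi_a : psi fa = fa * fa * fb^-1. Proof. exact: free_lift_gen. Qed.
Lemma psi_b : psi fb = fb * fa^-1. Proof. exact: free_lift_gen. Qed.

Lemma phiK : cancel phi psi.
Proof.
apply: presented_eq => [x y|//|c]; first by rewrite phiM psiM.
by case: c; rewrite -/fa -/fb ?phi_a ?phi_b !psiM psi_a psi_b; group_simp.
Qed.

Lemma psiK : cancel psi phi.
Proof.
apply: presented_eq => [x y|//|c]; first by rewrite psiM phiM.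
have phiV := morph_inv phiM.
by case: c; rewrite -/fa -/fb ?psi_a ?psi_b !phiM phiV phi_a phi_b; group_simp.
Qed.

Lemma phi_is_aut : is_aut phi.
Proof. by split; [exact: phiM|exists psi; [exact: phiK|exact: psiK]]. Qed.

Definition Phi : autom F2 := mk_aut phi_is_aut.

(** * The group as an extension of the integers by a free group *)

Local Notation G := listing_group.
Implicit Types (g h : G) (f : F2).

Definition fiber_a : G := a3 * a1^-1.
Definition fiber_b : G := fiber_a^-1 * (a1 * fiber_a * a1^-1).

(** The inclusion of the fibre group, a free group of rank two, as the kernel
    of [deg]. *)
Definition incl : F2 -> G := plift (pair_fun fiber_a fiber_b).

Lemma inclM : {morph incl : x y / x * y}. Proof. exact: free_liftM. Qed.
Lemma inclV : {morph incl : x / x^-1}. Proof. exact: morph_inv inclM. Qed.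
Lemma incl_a : incl fa = fiber_a. Proof. exact: free_lift_gen. Qed.
Lemma incl_b : incl fb = fiber_b. Proof. exact: free_lift_gen. Qed.

Lemma gens_fiber :
  [/\ a3 = fiber_a * a1, a4 = a1 * fiber_a * a1, a2 = fiber_a * a1 * a1
    & a5 = a1 * fiber_a * fiber_a * a1 * a1].
Proof.
have [e4 e2 e5 _] := listing_solved.
have e3 : a3 = fiber_a * a1 by rewrite /fiber_a; group_simp.
by split; rewrite // ?e5 ?e4 ?e2 e3; group_simp.
Qed.

Lemma listing_subgroup (S : set G) :
  subgroup S -> S a1 -> S fiber_a -> forall g, S g.
Proof.
move=> SS S1 Sa; apply: presented_subgroup => // x.
have [e3 e4 e2 e5] := gens_fiber; have /subgroupP[_ SM _] := SS.
by case: x; rewrite -/a1 -/a2 -/a3 -/a4 -/a5 ?e2 ?e3 ?e4 ?e5;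
  repeat first [exact S1 | exact Sa | apply SM].
Qed.

Lemma monodromy_a : a1 * fiber_a = fiber_a * fiber_b * a1.
Proof. by rewrite /fiber_b; group_simp. Qed.

Lemma monodromy_b : a1 * fiber_b = fiber_b * fiber_a * fiber_b * a1.
Proof.
have [e3 e4 e2 e5] := gens_fiber.
have [_ _ _ e5'] := listing_solved.
have /monodromy_relation <- := monodromy_a.
have := e5'; rewrite e5 e2 e3 e4.
by move: fiber_a => x /(congr1 (fun z => z * a1^-1)); group_simp.
Qed.

Lemma incl_conj f : a1 * incl f * a1^-1 = incl (phi f).
Proof.
apply: (presented_eq (p := fun f => a1 * incl f * a1^-1) (q := incl \o phi)).
- by move=> x y; rewrite inclM; group_simp.
- by move=> x y /=; rewrite phiM inclM.
- case; rewrite /= -/fa -/fb ?phi_a ?phi_b !inclM incl_a incl_b.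
    by rewrite monodromy_b; group_simp.
  by rewrite monodromy_a; group_simp.
Qed.

Lemma incl_conjV f : a1^-1 * incl f * a1 = incl (psi f).
Proof. by rewrite -{1}(psiK f) -incl_conj; group_simp. Qed.

(** The action of the group by conjugation on the fibre, defined without
    reference to the fact that the fibre is a subgroup; it shows that [incl] is
    injective, because it restricts to the inner automorphisms and the free
    group has trivial centre. *)
Definition monodromy_gen (x : listing_gen) : autom F2 :=
  let a := inner fa in
  match x with
  | A1 => Phi
  | A2 => a * Phi * Phi
  | A3 => a * Phi
  | A4 => Phi * a * Phi
  | A5 => Phi * a * a * Phi * Phi
  end.

Lemma innerM (H : groupType) : {morph @inner H : x y / x * y}.
Proof. by move=> x y; apply: autom_eq => z /=; group_simp. Qed.

Lemma aut_conj_inner (H : groupType) (h : autom H) x :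
  h * inner x = inner (h x) * h.
Proof.
have [hM _] := autP h; apply: autom_eq => z /=.
by rewrite !hM (morph_inv hM).
Qed.

(** The action satisfies the relation of [monodromy_relation] because [Phi]
    conjugates inner automorphisms by moving their argument. *)
Lemma monodromy_relators r :
  r \in listing_relators -> eval_word monodromy_gen r = 1.
Proof.
have Phi_a : Phi * inner fa = inner fa * inner fb * Phi.
  by rewrite (aut_conj_inner Phi) (_ : Phi fa = fa * fb) ?innerM //; exact: phi_a.
have Phi_b : Phi * inner fb = inner fb * inner fa * inner fb * Phi.
  by rewrite (aut_conj_inner Phi) (_ : Phi fb = fb * fa * fb) ?innerM //; exact: phi_b.
have rel := (monodromy_relation Phi_a).2 Phi_b.
apply: listing_evalP => /=; move: (inner fa) Phi rel => x t rel; group_simp => //.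
by have := congr1 (fun z => x * t^-1 * x^-1 * z * x^-1 * t^-1) rel; group_simp.
Qed.

Definition monodromy : G -> autom F2 := plift monodromy_gen.

Lemma monodromyM : {morph monodromy : x y / x * y}.
Proof. exact: pliftM monodromy_relators. Qed.

Lemma monodromy_incl f : monodromy (incl f) = inner f.
Proof.
have mV := morph_inv monodromyM.
have m1 : monodromy a1 = Phi by exact: (plift_gen monodromy_relators).
have m3 : monodromy a3 = inner fa * Phi by exact: (plift_gen monodromy_relators).
have ma : monodromy fiber_a = inner fa by rewrite /fiber_a monodromyM mV m1 m3; group_simp.
apply: (presented_eq (p := monodromy \o incl)) f => [x y|x y|c] /=.
- by rewrite inclM monodromyM.
- exact: innerM.
- case: c; rewrite -/fa -/fb ?incl_a ?incl_b // /fiber_b.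
  move: fiber_a ma => x mx; rewrite !monodromyM !mV m1 mx.
  rewrite (aut_conj_inner Phi) -(morph_inv (@innerM F2)) g_mulK -innerM.
  by congr inner; rewrite [Phi fa]phi_a; group_simp.
Qed.

Lemma incl_inj : injective incl.
Proof. by move=> f f' e; apply: inner_inj; rewrite -!monodromy_incl e. Qed.

Definition deg_gen (x : listing_gen) : addint :=
  match x with A1 | A3 => 1%R | A2 | A4 => 2%R | A5 => 3%R end.

Lemma deg_relators r : r \in listing_relators -> eval_word deg_gen r = 1.
Proof. by apply: listing_evalP. Qed.

(** The abelianisation of the group. *)
Definition deg (g : G) : int := plift deg_gen g.

Lemma degM g h : deg (g * h) = (deg g + deg h)%R.
Proof. exact: (pliftM deg_relators). Qed.

Lemma deg1 : deg 1 = 0%R.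
Proof. by have := degM 1 1; rewrite mulg1; lia. Qed.

Lemma degV g : deg g^-1 = (- deg g)%R.
Proof. by have := degM g^-1 g; rewrite mulVg deg1; lia. Qed.

Lemma deg_pgen x : deg (pgen listing_relators x) = deg_gen x.
Proof. exact: (plift_gen deg_relators). Qed.

Lemma deg_a1 : deg a1 = 1%R. Proof. exact: (deg_pgen A1). Qed.
Lemma deg_a3 : deg a3 = 1%R. Proof. exact: (deg_pgen A3). Qed.

Lemma deg_incl f : deg (incl f) = 0%R.
Proof.
have da : deg fiber_a = 0%R by rewrite /fiber_a degM degV deg_a1 deg_a3.
apply: (presented_subgroup (S := [set f | deg (incl f) = 0%R]%classic)).
  apply/subgroupP; split=> /= [|x y Sx Sy|x Sx].
  - by rewrite (morph_one inclM) deg1.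
  - by rewrite inclM degM Sx Sy.
  - by rewrite inclV degV Sx.
move=> c /=; case: c; rewrite -/fa -/fb ?incl_a ?incl_b //.
by rewrite /fiber_b; move: fiber_a da => x dx; rewrite !degM !degV dx; lia.
Qed.

Definition zpow (H : groupType) (x : H) (n : int) : H :=
  match n with Posz k => x ^+ k | Negz k => x ^- k.+1 end.

Lemma zpowS (H : groupType) (x : H) n : x * zpow x n = zpow x (n + 1)%R.
Proof.
case: n => [k|[|k]].
- by rewrite /= addn1 expgS.
- by rewrite /= expg1 mulgV.
- rewrite (_ : (Negz k.+1 + 1)%R = Negz k); last by lia.
  by rewrite /= (expgSr x k.+1) invgM mulVKg.
Qed.

(** The elements of this form are stable under left multiplication by a1, by
    the fibre, and by their inverses. *)
Lemma fiber_decomposition g : exists f, g = incl f * zpow a1 (deg g).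
Proof.
pose P g := exists f, g = incl f * zpow a1 (deg g).
(* The elements whose left translation preserves P in both directions form a
   subgroup, whereas P alone is not visibly closed under products. *)
suff /(_ g 1) : forall g h, P h <-> P (g * h).
  rewrite mulg1 => -[H _]; apply: H; exists 1.
  by rewrite (morph_one inclM) deg1 mul1g.
apply: (listing_subgroup (S := [set g | forall h, P h <-> P (g * h)]%classic)).
- apply/subgroupP; split=> /= [h|x y Sx Sy h|x Sx h]; first by rewrite mul1g.
    by rewrite -mulgA -Sx.
  by rewrite (Sx (x^-1 * h)) mulVKg.
- move=> h /=; split=> -[f e].
    by exists (phi f); rewrite {1}e degM deg_a1 addrC -zpowS -incl_conj; group_simp.
  exists (psi f); apply: (mulgI a1); rewrite e degM deg_a1 addrC -zpowS -incl_conjV.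
  by group_simp.
- move=> h /=; split=> -[f e].
    by exists (fa * f); rewrite {1}e inclM incl_a degM -incl_a deg_incl add0r; group_simp.
  exists (fa^-1 * f); apply: (mulgI fiber_a).
  by rewrite e inclM inclV incl_a degM -incl_a deg_incl add0r; group_simp.
Qed.

Lemma deg0_incl g : deg g = 0%R -> exists f, g = incl f.
Proof.
move=> d0; have [f e] := fiber_decomposition g.
by exists f; rewrite e d0 mulg1.
Qed.

(** * Automorphisms and their action on the homology of the fibre *)

Lemma int_mul_eq1 (m n : int) : (m * n = 1)%R -> (m = 1 \/ m = -1)%R.
Proof.
move/(congr1 absz); rewrite abszM => /eqP; rewrite muln_eq1 => /andP[/eqP m1 _].
lia.
Qed.

(** The relations force every homomorphism to the integers to take the same
    value on a1 and a3. *)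
Lemma deg_hom (chi : G -> int) :
  (forall g h, chi (g * h) = (chi g + chi h)%R) ->
  forall g, chi g = (chi a1 * deg g)%R.
Proof.
move=> chiM; have chi1 : chi 1 = 0%R by have := chiM 1 1; rewrite mulg1; lia.
have chiV g : chi g^-1 = (- chi g)%R by have := chiM g^-1 g; rewrite mulVg chi1; lia.
have [e4 e2 e5 e5'] := listing_solved.
have := congr1 chi e4; have := congr1 chi e2; have := congr1 chi e5.
have := congr1 chi e5'; rewrite !chiM !chiV => c5' c5 c2 c4.
apply: (presented_eq (H := addint) (p := chi) (q := fun g => (chi a1 * deg g)%R)) => [//|g h|x].
  by rewrite degM mulrDr.
by rewrite deg_pgen; case: x; rewrite -/a1 -/a2 -/a3 -/a4 -/a5 /=; lia.
Qed.

Implicit Types al be : autom G.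

(** The integer by which al multiplies degrees, see [deg_autE]. *)
Definition deg_aut al : int := deg (al a1).

Lemma autM al : {morph al : x y / x * y}. Proof. by case: (autP al). Qed.
Lemma autV al : {morph al : x / x^-1}. Proof. exact: morph_inv (@autM al). Qed.

Lemma aut_fixed al : subgroup [set x | al x = x]%classic.
Proof.
apply/subgroupP; split=> /= [|x y Sx Sy|x Sx]; last by rewrite autV Sx.
  exact: morph_one (@autM al).
by rewrite autM Sx Sy.
Qed.

Lemma deg_autE al g : deg (al g) = (deg_aut al * deg g)%R.
Proof. by apply: (deg_hom (chi := fun g => deg (al g))) => x y; rewrite autM degM. Qed.

Lemma deg_autM al be : deg_aut (al * be) = (deg_aut al * deg_aut be)%R.
Proof. by rewrite {1}/deg_aut /= deg_autE. Qed.

Lemma deg_aut_unit al : deg_aut al = 1%R \/ deg_aut al = (-1)%R.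
Proof.
apply: (@int_mul_eq1 _ (deg_aut al^-1)).
by rewrite -deg_autM mulgV /deg_aut deg_a1.
Qed.

Lemma deg_aut_inv al : deg_aut al = 1%R -> deg_aut al^-1 = 1%R.
Proof.
move=> d1; have : (deg_aut al * deg_aut al^-1%g)%R = 1%R.
  by rewrite -deg_autM mulgV /deg_aut deg_a1.
by rewrite d1 mul1r.
Qed.

Lemma aut_fiber al f : exists f', al (incl f) = incl f'.
Proof. by apply: deg0_incl; rewrite deg_autE deg_incl mulr0. Qed.

(** The fibre is the kernel of [deg] and hence preserved by every automorphism;
    u and v describe the restriction of al to it. *)
Definition fiber_image al (u v : F2) : Prop :=
  al (incl fa) = incl u /\ al (incl fb) = incl v.

Lemma fiber_image_exists al : exists u v, fiber_image al u v.
Proof. by have [[u eu] [v ev]] := (aut_fiber al fa, aut_fiber al fb); exists u, v. Qed.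

Lemma fiber_image_lift al u v f : fiber_image al u v ->
  al (incl f) = incl (plift (pair_fun u v) f).
Proof.
move=> [eu ev]; apply: (presented_eq (p := al \o incl) (q := incl \o plift (pair_fun u v))) f.
- by move=> x y /=; rewrite inclM autM.
- by move=> x y /=; rewrite free_liftM inclM.
- by move=> c /=; rewrite free_lift_gen; case: c.
Qed.

Lemma fiber_image_onto al u v f : fiber_image al u v ->
  exists f', plift (pair_fun u v) f' = f.
Proof.
move=> uv; have [f' e] := aut_fiber al^-1 f; exists f'.
apply: incl_inj; rewrite -(fiber_image_lift _ uv) -e.
exact: aut_inv_funVK.
Qed.

Lemma fiber_image_generates al u v : fiber_image al u v -> generates u v.
Proof.
move=> uv; apply/generatesP => S /subgroupP[S1 SM SV] Su Sv f.
have [f' <-] := fiber_image_onto f uv.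
apply: (presented_subgroup (S := [set f | S (plift (pair_fun u v) f)]%classic)) f'.
  have liftM := @free_liftM _ (pair_fun u v).
  apply/subgroupP; split=> /= [|x y Sx Sy|x Sx].
  - by rewrite (morph_one liftM).
  - by rewrite liftM; apply: SM.
  - by rewrite (morph_inv liftM); apply: SV.
by move=> c /=; rewrite free_lift_gen; case: c.
Qed.

(** Exponent sums form the abelianisation of the free group. *)
Lemma expo_hom (chi : F2 -> int) :
  (forall f f', chi (f * f') = (chi f + chi f')%R) ->
  forall f, chi f = (chi fa * expo false f + chi fb * expo true f)%R.
Proof.
move=> chiM.
apply: (presented_eq (H := addint) (p := chi)
  (q := fun f => (chi fa * expo false f + chi fb * expo true f)%R)) => [//|f f'|c].
  transitivity (chi fa * expo false f + chi fb * expo true f +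
    (chi fa * expo false f' + chi fb * expo true f'))%R => //.
  by rewrite !expoM; ring.
by rewrite -[pgen _ c]/(free_gen c) !expo_free_gen; case: c; rewrite /= -/fa -/fb; lia.
Qed.

Lemma expo_lift (c : bool) (u v f : F2) :
  expo c (plift (pair_fun u v) f) = (expo c u * expo false f + expo c v * expo true f)%R.
Proof.
rewrite (@expo_hom (fun f => expo c (plift (pair_fun u v) f))) ?free_lift_gen //.
by move=> x y; rewrite free_liftM expoM.
Qed.

Lemma expo_phi (c : bool) f : expo c (phi f) =
  (expo false f + (1 + c%:Z) * expo true f)%R.
Proof. by rewrite expo_lift !expoM !expo_free_gen; case: c => /=; ring. Qed.

(** An automorphism of degree one sends a1 to f0 a1 with f0 in the fibre, so
    its restriction commutes with [phi] up to an inner automorphism. On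
    exponent sums its matrix commutes with the square of C = (0 1; 1 1), which
    leaves p + q C, where (p, q) are the exponent sums of u. *)
Lemma expo_fiber_image al u v : deg_aut al = 1%R -> fiber_image al u v ->
  expo false v = expo true u /\ expo true v = (expo false u + expo true u)%R.
Proof.
move=> d1 uv; have [f0 e0] : exists f0, al a1 * a1^-1 = incl f0.
  by apply: deg0_incl; rewrite degM degV deg_a1 -/(deg_aut al) d1.
have alt : al a1 = incl f0 * a1 by rewrite -e0; group_simp.
(* The image under al of the relation a1 fa a1^-1 = fa fb in the fibre. *)
have e : f0 * phi u * f0^-1 = u * v.
  apply: incl_inj; rewrite !inclM inclV -incl_conj -uv.1 -uv.2.
  by rewrite -autM -inclM -phi_a -incl_conj !autM autV alt; group_simp.
by have := congr1 (expo false) e; have := congr1 (expo true) e;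
  rewrite !expoM !expoV !expo_phi /=; lia.
Qed.

(** The matrix p + q C is invertible over the integers, so its determinant, the
    norm of p + q C, is a unit. *)
Lemma fiber_image_norm al u v : deg_aut al = 1%R -> fiber_image al u v ->
  let p := expo false u in let q := expo true u in
  (p * (p + q) - q * q = 1 \/ p * (p + q) - q * q = -1)%R.
Proof.
move=> d1 uv p q; have [v0 v1] := expo_fiber_image d1 uv.
have [x ex] := fiber_image_onto fa uv; have [y ey] := fiber_image_onto fb uv.
have := congr1 (expo false) ex; have := congr1 (expo true) ex.
have := congr1 (expo false) ey; have := congr1 (expo true) ey.
rewrite !expo_lift v0 v1 -/p -/q !expo_free_gen /=.
move: (expo false x) (expo true x) (expo false y) (expo true y).
move=> x0 x1 y0 y1 h1 h2 h3 h4.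
apply: (@int_mul_eq1 _ (x0 * y1 - x1 * y0)%R).
transitivity ((p * x0 + q * x1) * (q * y0 + (p + q) * y1)
  - (p * y0 + q * y1) * (q * x0 + (p + q) * x1))%R; first by ring.
by rewrite h1 h2 h3 h4.
Qed.

(** By Nielsen reduction the restriction to the fibre is inner. After
    correction by an inner automorphism al fixes the fibre pointwise; then a1
    and its image induce the same conjugation of the fibre, so they differ by
    an element centralising the fibre, which is trivial. *)
Lemma ia_aut_inner al u v : deg_aut al = 1%R -> fiber_image al u v ->
  expo false u = 1%R -> expo true u = 0%R -> exists g, al = inner g.
Proof.
move=> d1 uv u0 u1; have [v0 v1] := expo_fiber_image d1 uv.
have [||g [gu gv]] := basis_ia_conj (nielsen_reduction (fiber_image_generates uv)) u0 u1.
- by rewrite v0.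
- by rewrite v1 u0 u1.
pose ga : autom G := inner (incl g) * al.
have ga_fiber f : ga (incl f) = incl f.
  rewrite (@fiber_image_lift ga fa fb).
    congr incl; apply: (presented_eq (q := id)) f => // [x y|c].
      exact: free_liftM.
    by rewrite free_lift_gen; case: c.
  by split; rewrite /= ?uv.1 ?uv.2 -inclV -!inclM ?gu ?gv.
have [f0 e0] : exists f0, ga a1 * a1^-1 = incl f0.
  by apply: deg0_incl; rewrite /ga /= !degM !degV -/(deg_aut al) d1 deg_a1; lia.
have gat : ga a1 = incl f0 * a1 by rewrite -e0; group_simp.
(* ga fixes a1 f a1^-1 and f, hence f0 centralises the fibre. *)
have f0_1 : f0 = 1.
  have comm f : commute f0 f.
    rewrite -(psiK f); apply: incl_inj; rewrite !inclM -incl_conj.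
    have := ga_fiber (phi (psi f)); rewrite -incl_conj !autM autV ga_fiber gat.
    by move/(congr1 (fun z => z * incl f0)); group_simp => ->.
  by apply: (@center_free _ false true).
have ga1 x : ga x = x.
  apply: (listing_subgroup (aut_fixed ga)) x.
    by rewrite /mkset gat f0_1 (morph_one inclM) mul1g.
  by have := ga_fiber fa; rewrite incl_a.
exists (incl g)^-1; apply: autom_eq => x.
by rewrite -{2}(ga1 x) /ga /=; group_simp.
Qed.

Lemma generated_subgroup (H : groupType) (A : set H) : subgroup (generated A).
Proof.
apply/subgroupP; split=> [S [/subgroupP[S1 _ _] _] //|x y Sx Sy S SA|x Sx S SA].
- by have /subgroupP[_ SM _] := SA.1; apply: SM; [apply: Sx|apply: Sy].
- by have /subgroupP[_ _ SV] := SA.1; apply: SV; apply: Sx.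
Qed.

Lemma sub_generated (H : groupType) (A : set H) x : A x -> generated A x.
Proof. by move=> Ax S [_]; apply. Qed.

(** * A fundamental unit realised by the listed automorphisms *)

(** Acts on exponent sums by 1 - C, a unit which together with -1 generates all
    units of the ring of the p + q C. *)
Definition golden : autom G := inner a1 * j0 * j1.

(** In the fibration t = a1, x = [fiber_a], y = [fiber_b]; the left-hand side
    is the image of x under [golden]. *)
Lemma golden_relation (H : groupType) (t x y : H) :
  t * x = x * y * t -> t * y = y * x * y * t -> x^-1 * (t^-1 * x * t) = x * y^-1.
Proof.
move=> tx ty; apply: (mulgI (t * x)).
have tyV : t * y^-1 = (y * x * y)^-1 * t.
  by apply: (mulIg y); rewrite g_mulVK -mulgA ty mulKg.
transitivity (x * t); first by group_simp.
by rewrite tx -(mulgA _ t) (mulgA t x) tx -(mulgA _ t) tyV; group_simp.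
Qed.

Lemma golden_fiber_a : golden (incl fa) = incl (fa * fb^-1).
Proof.
have [e1 e2 e3 e4 e5] := j1_funE; have [k1 k2 k3 k4 k5] := j0_funE.
have [_ g4 g2 _] := gens_fiber.
rewrite incl_a /golden /= {1}/fiber_a.
rewrite (j1_funM a3) (listing_morphV j1_funM) e1 e3.
rewrite g_invM g_invK g_mulA g_mulVK j0_funM (listing_morphV j0_funM) k4 k2 g_invK.
rewrite inclM inclV incl_b incl_a.
by rewrite -(golden_relation monodromy_a monodromy_b) g4 g2; move: fiber_a => x; group_simp.
Qed.

Lemma deg_j1 : deg_aut j1 = (-1)%R.
Proof.
have [e1 _ _ _ _] := j1_funE; rewrite /deg_aut /= e1 degM degV.
by have := deg_pgen A2; have := deg_pgen A5; rewrite -/a2 -/a5 => -> ->.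
Qed.

Lemma deg_golden : deg_aut golden = 1%R.
Proof.
have [k1 _ _ _ _] := j0_funE.
have d0 : deg_aut j0 = (-1)%R by rewrite /deg_aut /= k1 degV deg_a3.
have dt : deg_aut (inner a1) = 1%R by rewrite /deg_aut /= !degM degV deg_a1.
by rewrite /golden !deg_autM dt d0 deg_j1.
Qed.

(** Hence the square of j1 acts on exponent sums by -1. *)
Lemma j1_square_fiber_a : (j1 * j1) (incl fa) = incl fa^-1.
Proof.
have [e1 e2 e3 e4 e5] := j1_funE; have jV := listing_morphV j1_funM.
rewrite inclV incl_a /= /fiber_a.
rewrite (j1_funM a3) jV e1 e3 g_invM g_invK g_mulA g_mulVK.
by rewrite (j1_funM a4) jV e2 e4 !g_invM !g_invK g_mulA g_mulVK.
Qed.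

Lemma fiber_image_comp al be u v u' v' w (c : bool) :
  fiber_image al u v -> fiber_image (al * be) u' v' -> be (incl fa) = incl w ->
  expo c u' = (expo c u * expo false w + expo c v * expo true w)%R.
Proof.
move=> uv [eu' _] ew; rewrite -expo_lift; congr expo; apply: incl_inj.
by rewrite -eu' -(fiber_image_lift _ uv) -ew.
Qed.

(** If p q is nonnegative, the norm equation forces |p| <= |q| and
    multiplication by 1 - C, which sends (p, q) to (p - q, - p), lowers the
    measure; otherwise |q| < 3 |p| and |p| < 3 |q|, and the inverse unit - C
    lowers it. *)
Lemma golden_descent (p q : int) : q <> 0%R ->
  (p * (p + q) - q * q = 1 \/ p * (p + q) - q * q = -1)%R ->
  (absz (p - q)%R + 2 * absz p < absz p + 2 * absz q)%N \/
  (absz q + 2 * absz (p + q)%R < absz p + 2 * absz q)%N.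
Proof.
wlog q_gt0 : p q / (0 < q)%R => [wl q0 norm|_ norm].
  have [|q_le0] := boolP (0 < q)%R; first by move=> ?; apply: wl.
  have := wl (- p)%R (- q)%R; rewrite -!opprD !mulrNN.
  by move=> /(_ ltac:(lia) ltac:(lia) norm) H; lia.
have [p_ge0|p_lt0] := boolP (0 <= p)%R.
  have : (p <= q)%R by nia.
  by left; lia.
have : (q < - (3 * p))%R by nia.
have : (- p < 3 * q)%R by nia.
by right; lia.
Qed.

(** * The subgroup generated by the listed automorphisms *)

Section Generators.

Notation listed := (generated ([set j0; j1] `|` Inn G)%classic).

Lemma listed_group : [/\ listed 1,
  forall x y, listed x -> listed y -> listed (x * y) &
  forall x, listed x -> listed x^-1].
Proof. exact/subgroupP/generated_subgroup. Qed.

Lemma listed_inner g : listed (inner g).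
Proof. by apply: sub_generated; right; exists g. Qed.

Lemma listed_j0 : listed j0. Proof. by apply: sub_generated; left; left. Qed.
Lemma listed_j1 : listed j1. Proof. by apply: sub_generated; left; right. Qed.

Lemma listed_golden : listed golden.
Proof.
by have [_ HM _] := listed_group; exact (HM _ _ (HM _ _ (listed_inner a1) listed_j0) listed_j1).
Qed.

Lemma listed_mulr al be : listed be -> listed (al * be) -> listed al.
Proof.
move=> Hb Hab; have [_ HM HV] := listed_group.
by rewrite -(mulgK be al); apply: (HM _ _ Hab); apply: HV.
Qed.

(** Descent on the unit p + q C by powers of [golden] leads to q = 0 and p = 1
    or p = -1; the square of j1 removes the sign, and [ia_aut_inner] concludes.
    *)
Lemma listed_deg1 al : deg_aut al = 1%R -> listed al.
Proof.
have [u [v uv]] := fiber_image_exists al.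
have [n] := ubnP (absz (expo false u) + 2 * absz (expo true u))%N.
elim: n al u v uv => // n IHn al u v uv le_n d1.
have [v0 v1] := expo_fiber_image d1 uv; have /= := fiber_image_norm d1 uv.
set p := expo false u in le_n v0 v1 *; set q := expo true u in le_n v0 v1 *.
move=> norm; have [q0|q0] := eqVneq q 0%R.
  have [p1|p1] : (p = 1 \/ p = -1)%R.
    by move: norm; rewrite q0 mulr0 subr0 addr0; case=> [/int_mul_eq1//|]; nia.
    by have [g ->] := ia_aut_inner d1 uv p1 q0; exact: listed_inner.
  apply: (@listed_mulr al (j1 * j1)).
    by have [_ HM _] := listed_group; apply: HM; exact: listed_j1.
  have [u' [v' uv']] := fiber_image_exists (al * (j1 * j1)).
  have comp c := fiber_image_comp c uv uv' j1_square_fiber_a.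
  have d1' : deg_aut (al * (j1 * j1)) = 1%R by rewrite !deg_autM d1 deg_j1.
  have [||g ->] := ia_aut_inner d1' uv'; last exact: listed_inner.
    by rewrite comp !expoV !expo_free_gen -/p p1 /=; lia.
  by rewrite comp !expoV !expo_free_gen -/q q0 /=; lia.
(* Multiplication by golden or by its inverse lowers |p| + 2 |q|. *)
have [lt|lt] := golden_descent (elimN eqP q0) norm.
  apply: (@listed_mulr al golden listed_golden).
  have [u' [v' uv']] := fiber_image_exists (al * golden).
  have comp c := fiber_image_comp c uv uv' golden_fiber_a.
  apply: (IHn _ u' v' uv'); last by rewrite deg_autM d1 deg_golden.
  have := comp false; have := comp true.
  rewrite !expoM !expoV !expo_free_gen v0 v1 -/p -/q /=.
  move: (expo false u') (expo true u') => p' q'; lia.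
have [_ HM HV] := listed_group.
rewrite -(mulgVK golden al); apply: HM listed_golden.
have [u' [v' uv']] := fiber_image_exists (al * golden^-1).
have d1' : deg_aut (al * golden^-1) = 1%R by rewrite deg_autM d1 (deg_aut_inv deg_golden).
have uv2 : fiber_image (al * golden^-1 * golden) u v by rewrite mulgVK.
have comp c := fiber_image_comp c uv' uv2 golden_fiber_a.
have [v0' v1'] := expo_fiber_image d1' uv'.
apply: (IHn _ u' v' uv') => //.
have := comp false; have := comp true.
rewrite !expoM !expoV !expo_free_gen v0' v1' -/p -/q /=.
move: (expo false u') (expo true u') => p' q'; lia.
Qed.

End Generators.

Local Open Scope classical_set_scope.

Theorem mainTheorem5 :
  generated ([set j0; j1] `|` Inn listing_group) = [set: autom listing_group].
Proof.
apply/seteqP; split=> // al _.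
have [/listed_deg1 //|dN] := deg_aut_unit al.
by apply: (listed_mulr listed_j1); apply: listed_deg1; rewrite deg_autM dN deg_j1.
Qed.
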